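(* Let $F$ be an Archimedean Riesz space and let $F^\sigma$ be its sequential order closure. Then the Riesz completion $\mathcal{L}^r(\ell^\infty_0,F)^\rho$ of $\mathcal{L}^r(\ell^\infty_0,F)$ may be identified with the space of operators $$H=\{T\in \mathcal{L}^r(\ell^\infty_0,F^\sigma): Te_n\in F\ \text{for all } n\in\mathbb{N}\}.$$ That is, with the pointwise linear operations and the operator order, $H$ is a Riesz space, and $\mathcal{L}^r(\ell^\infty_0,F)$, regarded as a subspace of $H$ via the inclusion $F\subseteq F^\sigma$, is order dense in $H$ and generates $H$ as a Riesz space.
   Context: $\ell^\infty_0$ is the Riesz space of eventually constant real sequences with pointwise operations and order. For $n\in\mathbb{N}=\{1,2,\dots\}$, $e_n$ is the sequence with $n$-th term $1$ and all other terms $0$. For Riesz spaces $E,G$, $\mathcal{L}^r(E,G)$ is the space of regular operators (differences of two positive linear operators) from $E$ to $G$, ordered by $S\le T$ iff $Sx\le Tx$ for all $x\ge 0$. A linear subspace $E$ of a partially ordered vector space $G$ is order dense in $G$ if $y=\inf\{x\in E:x\ge y\}$ for every $y\in G$ (equivalently $y=\sup\{x\in E:x\le y\}$ for every $y\in G$). Every directed (positively generated) Archimedean partially ordered vector space $E$ is a so-called pre-Riesz space. A Riesz space $G$ is a vector lattice cover of a pre-Riesz space $E$ if there is a bipositive linear map $i:E\to G$ (i.e. $x\ge0\iff i(x)\ge0$) with $i(E)$ order dense in $G$; if also $i(E)$ generates $G$ as a Riesz space, $G$ is called the Riesz completion of $E$, denoted $E^\rho$. It exists and is essentially unique. Sequential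 order closure: for an Archimedean Riesz space $F$, $F^\sigma$ denotes its (essentially unique) sequential order closure, i.e. an Archimedean Riesz space $F^\sigma\supseteq F$ such that (1) $F$ is an order dense vector sublattice of $F^\sigma$; (2) any increasing sequence in $F$ with a supremum in $F$ has the same supremum in $F^\sigma$; (3) every increasing sequence in $F$ which is bounded above has a supremum in $F^\sigma$; (4) condition (3) does not hold for any strictly smaller vector sublattice of $F^\sigma$ (containing $F$). Such a space always exists. *)

(* Defs.v *)
From HB Require Import structures.
From mathcomp Require Import all_boot all_order all_algebra.
From mathcomp Require Import boolp classical_sets functions reals.

Set Implicit Arguments.
Unset Strict Implicit.
Unset Printing Implicit Defensive.

Import Order.TTheory GRing.Theory Num.Theory.

Local Open Scope classical_set_scope.
Local Open Scope ring_scope.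

HB.mixin Record Lmodule_POrder_isOVS (R : numDomainType) E
    of GRing.Lmodule R E & Order.POrder ring_display E := {
  lev_add2r : forall z x y : E, x <= y -> x + z <= y + z;
  lev_scale2l : forall (a : R) (x y : E), 0 <= a -> x <= y -> a *: x <= a *: y
}.

#[short(type="ovsType")]
HB.structure Definition OVS (R : numDomainType) :=
  { E of GRing.Lmodule R E & Order.POrder ring_display E
    & Lmodule_POrder_isOVS R E }.

Definition is_riesz (R : numDomainType) (E : ovsType R) : Prop :=
  forall x y : E, (exists z, supremums [set x; y] z) /\
                  (exists z, infimums [set x; y] z).

HB.mixin Record OVS_isRiesz (R : numDomainType) E of OVS R E := {
  riesz_lattice : is_riesz E
}.

#[short(type="rieszType")]
HB.structure Definition Riesz (R : numDomainType) :=
  { E of OVS R E & OVS_isRiesz R E }.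

Section OVSNotions.
Context {R : numDomainType}.

Definition archimedean (E : ovsType R) : Prop := forall x y : E,
  (forall n : nat, (0 < n)%N -> x *+ n <= y) -> x <= 0.

Definition bipositive (E G : ovsType R) (f : E -> G) : Prop :=
  forall x, 0 <= x <-> 0 <= f x.

Definition linear_subspace (E : ovsType R) (A : set E) : Prop :=
  A 0 /\ forall (a : R) x y, A x -> A y -> A (a *: x + y).

(* Suprema and infima are those of the ambient space. *)
Definition vector_sublattice (E : ovsType R) (A : set E) : Prop :=
  linear_subspace A /\
  forall x y z, A x -> A y ->
    supremums [set x; y] z \/ infimums [set x; y] z -> A z.

Definition order_dense (E : ovsType R) (A : set E) : Prop :=
  forall y, infimums (A `&` [set x | y <= x]) y.

Definition riesz_generates (E : ovsType R) (A : set E) : Prop :=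
  forall B : set E, vector_sublattice B -> A `<=` B -> B = setT.

Definition riesz_completion (E G : ovsType R) (j : {linear E -> G}) : Prop :=
  [/\ is_riesz G, bipositive j, order_dense (range j)
    & riesz_generates (range j)].

Definition increasing (E : ovsType R) (u : nat -> E) : Prop :=
  {homo u : m n / (m <= n)%N >-> m <= n}.

(* Least upper bounds of [U] relative to the ordered subset [A]. *)
Definition supremums_in (E : ovsType R) (A U : set E) : set E :=
  A `&` ubound U `&` lbound (A `&` ubound U).

(* Every increasing sequence of [F] that is bounded above has a supremum in the
   subset [A] of [G], [F] being viewed in [G] through [i]. *)
Definition seq_sups_in (F G : ovsType R) (i : F -> G) (A : set G) : Prop :=
  forall u : nat -> F, increasing u -> has_ubound (range u) ->
  exists z, supremums_in A (range (i \o u)) z.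

(* [i : F -> G] exhibits [G] as the sequential order closure of [F]. *)
Record seq_order_closure (F G : rieszType R) (i : {linear F -> G}) : Prop := {
  soc_archimedean : archimedean G;
  soc_bipositive : bipositive i;
  soc_sublattice : vector_sublattice (range i);
  soc_dense : order_dense (range i);
  soc_sup : forall (u : nat -> F) (x : F), increasing u ->
    supremums (range u) x -> supremums (range (i \o u)) (i x);
  soc_complete : seq_sups_in i setT;
  soc_minimal : forall A : set G, vector_sublattice A -> range i `<=` A ->
    seq_sups_in i A -> A = setT
}.

Definition positive_op (E G : ovsType R) (f : E -> G) : Prop :=
  forall x, 0 <= x -> 0 <= f x.

Definition regular_op (E G : ovsType R) (f : E -> G) : Prop :=
  exists S1 S2 : {linear E -> G},
    [/\ positive_op S1, positive_op S2 & forall x, f x = S1 x - S2 x].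

Lemma subv_ge0 (E : ovsType R) (x y : E) : (0 <= y - x) = (x <= y).
Proof.
apply/idP/idP => [/(lev_add2r x)|/(lev_add2r (- x))].
  by rewrite add0r subrK.
by rewrite subrr.
Qed.

Lemma addv_ge0 (E : ovsType R) (x y : E) : 0 <= x -> 0 <= y -> 0 <= x + y.
Proof. by move=> x0 /(lev_add2r x); rewrite add0r addrC; apply: le_trans. Qed.

Lemma scalev_ge0 (E : ovsType R) (a : R) (x : E) :
  0 <= a -> 0 <= x -> 0 <= a *: x.
Proof. by move=> a0 /(lev_scale2l _ _ _ a0); rewrite scaler0. Qed.

(* Directedness of [E] makes the operator order below antisymmetric. *)
Lemma riesz_directed (E : rieszType R) (x : E) :
  exists a b : E, [/\ 0 <= a, 0 <= b & x = a - b].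
Proof.
have [[z [zub _]] _] := riesz_lattice x 0.
exists z, (z - x); split; first by apply: zub; right.
  by rewrite subv_ge0; apply: zub; left.
by rewrite opprB addrC subrK.
Qed.

End OVSNotions.

Section RegularOperators.
Context {R : realDomainType} (E G : rieszType R).

Definition regular_pred : {pred E -> G} := fun f => `[< regular_op f >].

Record regop := RegOp { regop_fun :> E -> G; _ : regular_pred regop_fun }.

HB.instance Definition _ := [isSub for regop_fun].
HB.instance Definition _ := [Choice of regop by <:].

Fact regular_pred_submod : subsemimod_closed regular_pred.
Proof.
apply: GRing.submod_closed_semi; split=> [|a f g /asboolP[S1 [S2 [p1 p2 Sf]]]
    /asboolP[T1 [T2 [q1 q2 Tg]]]].
  by apply/asboolP; exists \0, \0; split=> // x; rewrite /= subrr.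
apply/asboolP; have [a0|/ltW a0] := leP 0 a.
  exists (a \*: S1 \+ T1), (a \*: S2 \+ T2); split=> x /=.
  - by move=> x0; apply: addv_ge0; [apply: scalev_ge0 => //; exact: p1|exact: q1].
  - by move=> x0; apply: addv_ge0; [apply: scalev_ge0 => //; exact: p2|exact: q2].
  - rewrite [LHS](_ : _ = a *: f x + g x)// Sf Tg scalerBr.
    by rewrite opprD addrACA.
have na0 : 0 <= - a by rewrite oppr_ge0.
exists (- a \*: S2 \+ T1), (- a \*: S1 \+ T2); split=> x /=.
- by move=> x0; apply: addv_ge0; [apply: scalev_ge0 => //; exact: p2|exact: q1].
- by move=> x0; apply: addv_ge0; [apply: scalev_ge0 => //; exact: p1|exact: q2].
- rewrite [LHS](_ : _ = a *: f x + g x)// Sf Tg scalerBr.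
  rewrite !scaleNr opprD opprK [RHS]addrACA; congr (_ + _).
  by rewrite addrC.
Qed.

HB.instance Definition _ :=
  GRing.SubChoice_isSubLmodule.Build R (E -> G) regular_pred regop
    regular_pred_submod.

Definition le_regop (S T : regop) : bool :=
  `[< forall x, 0 <= x -> S x <= T x >].

Fact le_regop_refl : reflexive le_regop.
Proof. by move=> S; apply/asboolP. Qed.

Fact regopB (T : regop) x y : T (x - y) = T x - T y.
Proof.
case: T => f /= /asboolP[S1 [S2 [_ _ Sf]]].
by rewrite !Sf (linearB S1) (linearB S2) !opprD !opprK addrACA.
Qed.

Fact le_regop_anti : antisymmetric le_regop.
Proof.
move=> S T /andP[/asboolP ST /asboolP TS]; apply/val_inj/funext => x /=.
have [a [b [a0 b0 ->]]] := riesz_directed x.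
by rewrite !regopB; congr (_ - _); apply/eqP; rewrite eq_le ?ST ?TS.
Qed.

Fact le_regop_trans : transitive le_regop.
Proof.
move=> T S U /asboolP ST /asboolP TU; apply/asboolP => x x0.
exact: le_trans (ST _ x0) (TU _ x0).
Qed.

HB.instance Definition _ := Order.Le_isPOrder.Build ring_display regop
  le_regop_refl le_regop_anti le_regop_trans.

Fact regop_lev_add2r (U S T : regop) : S <= T -> S + U <= T + U.
Proof. by move=> /asboolP ST; apply/asboolP => x /ST; apply: lev_add2r. Qed.

Fact regop_lev_scale2l (a : R) (S T : regop) :
  0 <= a -> S <= T -> a *: S <= a *: T.
Proof.
by move=> a0 /asboolP ST; apply/asboolP => x /ST; apply: lev_scale2l.
Qed.

HB.instance Definition _ :=
  Lmodule_POrder_isOVS.Build R regop regop_lev_add2r regop_lev_scale2l.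

End RegularOperators.

Section EventuallyConstant.
Context (R : realDomainType).

Definition ev_const_pred : {pred nat -> R^o} := fun x =>
  `[< exists N : nat, forall n : nat, (N <= n)%N -> x n = x N >].

Record linf0 := Linf0 { linf0_fun :> nat -> R^o; _ : ev_const_pred linf0_fun }.

HB.instance Definition _ := [isSub for linf0_fun].
HB.instance Definition _ := [Choice of linf0 by <:].

Fact ev_const_map2 (f : R -> R -> R) (x y : nat -> R) :
  ev_const_pred x -> ev_const_pred y -> ev_const_pred (fun n => f (x n) (y n)).
Proof.
move=> /asboolP[N xN] /asboolP[M yM]; apply/asboolP; exists (maxn N M) => n.
rewrite geq_max => /andP[Nn Mn].
by rewrite xN// yM// [in RHS]xN ?leq_maxl// [in RHS]yM ?leq_maxr.
Qed.

Fact ev_const_submod : subsemimod_closed ev_const_pred.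
Proof.
apply: GRing.submod_closed_semi; split=> [|a x y]; first by apply/asboolP; exists 0%N.
exact: (@ev_const_map2 (fun s t => a * s + t)).
Qed.

HB.instance Definition _ :=
  GRing.SubChoice_isSubLmodule.Build R (nat -> R^o) ev_const_pred linf0
    ev_const_submod.

Definition le_linf0 (x y : linf0) : bool := `[< forall n, x n <= y n >].

Fact le_linf0_refl : reflexive le_linf0.
Proof. by move=> x; apply/asboolP. Qed.

Fact le_linf0_anti : antisymmetric le_linf0.
Proof.
move=> x y /andP[/asboolP xy /asboolP yx]; apply/val_inj/funext => n.
by apply/eqP; rewrite eq_le xy yx.
Qed.

Fact le_linf0_trans : transitive le_linf0.
Proof.
move=> y x z /asboolP xy /asboolP yz; apply/asboolP => n.
exact: le_trans (xy n) (yz n).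
Qed.

HB.instance Definition _ := Order.Le_isPOrder.Build ring_display linf0
  le_linf0_refl le_linf0_anti le_linf0_trans.

Definition linf0_meet (x y : linf0) : linf0 :=
  Linf0 (ev_const_map2 Num.min (valP x) (valP y)).

Definition linf0_join (x y : linf0) : linf0 :=
  Linf0 (ev_const_map2 Num.max (valP x) (valP y)).

Fact linf0_meetP x y z : (x <= linf0_meet y z) = (x <= y) && (x <= z).
Proof.
apply/asboolP/andP => [h|[/asboolP xy /asboolP xz] n].
  by split; apply/asboolP => n; have := h n; rewrite le_min => /andP[].
by rewrite /= le_min xy xz.
Qed.

Fact linf0_joinP x y z : (linf0_join x y <= z) = (x <= z) && (y <= z).
Proof.
apply/asboolP/andP => [h|[/asboolP xz /asboolP yz] n].
  by split; apply/asboolP => n; have := h n; rewrite ge_max => /andP[].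
by rewrite /= ge_max xz yz.
Qed.

Fact linf0_lev_add2r (z x y : linf0) : x <= y -> x + z <= y + z.
Proof. by move=> /asboolP xy; apply/asboolP => n; exact: lerD. Qed.

Fact linf0_lev_scale2l (a : R) (x y : linf0) :
  0 <= a -> x <= y -> a *: x <= a *: y.
Proof.
by move=> a0 /asboolP xy; apply/asboolP => n; exact: ler_wpM2l.
Qed.

HB.instance Definition _ :=
  Lmodule_POrder_isOVS.Build R linf0 linf0_lev_add2r linf0_lev_scale2l.

Fact linf0_is_riesz : is_riesz linf0.
Proof.
move=> x y; split.
  have /andP[xj yj] : (x <= linf0_join x y) && (y <= linf0_join x y).
    by rewrite -linf0_joinP.
  exists (linf0_join x y); split=> [_ [->|->]//|z zub].
  by rewrite linf0_joinP !zub//; [right|left].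
have /andP[mx my] : (linf0_meet x y <= x) && (linf0_meet x y <= y).
  by rewrite -linf0_meetP.
exists (linf0_meet x y); split=> [_ [->|->]//|z zlb].
by rewrite linf0_meetP !zlb//; [right|left].
Qed.

HB.instance Definition _ := OVS_isRiesz.Build R linf0 linf0_is_riesz.

Fact unit_seq_ev_const (k : nat) :
  ev_const_pred (fun n => (n == k)%:R : R).
Proof.
by apply/asboolP; exists k.+1 => n kn; rewrite !gtn_eqF.
Qed.

(* Sequences are indexed from 0, so the family [unit_seq 0, unit_seq 1, ...]
   is $e_1, e_2, \dots$. *)
Definition unit_seq (k : nat) : linf0 := Linf0 (unit_seq_ev_const k).

End EventuallyConstant.

Section SpaceH.
Context {R : realDomainType} (F Fs : rieszType R) (i : {linear F -> Fs}).

Definition spaceH_pred : {pred regop (linf0 R) Fs} :=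
  fun T => `[< forall n, range i (T (unit_seq R n)) >].

Record spaceH := SpaceH {
  spaceH_op :> regop (linf0 R) Fs; _ : spaceH_pred spaceH_op }.

HB.instance Definition _ := [isSub for spaceH_op].
HB.instance Definition _ := [Choice of spaceH by <:].

Fact spaceH_submod : subsemimod_closed spaceH_pred.
Proof.
apply: GRing.submod_closed_semi; split=> [|a S T /asboolP Si /asboolP Ti].
  by apply/asboolP => n; exists 0; rewrite // linear0.
apply/asboolP => n; have [[x _ xS] [y _ yT]] := (Si n, Ti n).
by exists (a *: x + y) => //; rewrite linearP xS yT.
Qed.

HB.instance Definition _ :=
  GRing.SubChoice_isSubLmodule.Build R (regop (linf0 R) Fs) spaceH_pred spaceH
    spaceH_submod.
HB.instance Definition _ :=
  Order.SubChoice_isSubPOrder.Build ring_display (regop (linf0 R) Fs)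
    spaceH_pred ring_display spaceH.

Fact spaceH_lev_add2r (U S T : spaceH) : S <= T -> S + U <= T + U.
Proof. exact: (lev_add2r (val U)). Qed.

Fact spaceH_lev_scale2l (a : R) (S T : spaceH) :
  0 <= a -> S <= T -> a *: S <= a *: T.
Proof. exact: (lev_scale2l a (val S) (val T)). Qed.

HB.instance Definition _ :=
  Lmodule_POrder_isOVS.Build R spaceH spaceH_lev_add2r spaceH_lev_scale2l.

End SpaceH.

(* Main.v *)
From HB Require Import structures.
Require Import Defs.
From mathcomp Require Import all_boot all_order all_algebra.
From mathcomp Require Import boolp classical_sets functions reals.

Set Implicit Arguments.
Unset Strict Implicit.
Unset Printing Implicit Defensive.

Import Order.TTheory GRing.Theory Num.Theory.

Local Open Scope classical_set_scope.
Local Open Scope ring_scope.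

(** Write $u_n$ for the unit sequences and $1_N$ for the indicator sequence of
    $[N, \infty)$, so that $1_0$ is the constant sequence 1. A sequence that is
    constant from $N$ on equals $\sum_{n<N} x_n u_n + x_N 1_N$ ([linf0_expand]).
    Hence a linear operator $T$ on $\ell^\infty_0$ is a free choice of coordinates
    $t_n = T u_n$ and $t = T 1_0$, and $T \ge 0$ iff all $t_n \ge 0$ and all
    $T 1_N = t - \sum_{n<N} t_n \ge 0$ ([regop_leP]). All three claims are
    about these coordinates. Below, $G$ is the sequential order closure of $F$.

    Riesz property. The positive part $P$ of $T \in H$ must satisfy
    $P u_n = t_n^+$, and must take at $1_0$ the supremum over $N$ of
    $\sum_{n<N} t_n^+ + (T 1_N)^+
      = (t + \sum_{n<N} t_n^-) \vee \sum_{n<N} t_n^+$,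
    that is $(t + a) \vee b$, where $a$ and $b$ are the sums of the series of
    $t_n^-$ and $t_n^+$ ([spaceH_pos_part]). Regularity of $T$ bounds the
    partial sums of both series, and since $t_n \in F$ they are increasing
    sequences of $F$, so $a$ and $b$ exist in $G$: here the condition
    $T u_n \in F$ and the completion of $F$ meet ([spaceH_riesz]).

    Order density. Every $T \in H$ differs from an operator into $F$ only by a
    multiple of the limit: for any $s \in F$, replacing $t$ by $s$ gives a
    regular operator into $F$ ([spaceH_change_limit]). Taking all $s \in F$
    above $t$ gives enough majorants of $T$, because $F$ is order dense in $G$
    ([embed_dense]).

    Generation. By the same lemma it suffices that a sublattice $B$ of $H$
    containing the operators into $F$ contains $x \mapsto (\lim x) z$ for all
    $z \in G$. These $z$ form a sublattice of $G$ containing $F$, which is all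
    of $G$ by minimality once it contains the supremum $z$ of each increasing
    sequence $(f_n)$ of $F$ that is bounded above. Now the operator with
    coordinates $t_n = f_{n+1} - f_n$ and $t = 0$ lies in $B$, and by the
    formula above its positive part has the same $t_n$ and $t = z - f_0$:
    subtracting the two operators leaves $x \mapsto (\lim x) (z - f_0)$
    ([limit_op_sup_seq]). *)

(** * Ordered vector spaces *)

Section OrderedVectorSpaces.
Context {R : numDomainType}.
Implicit Types E : ovsType R.

Lemma levD E (x y z t : E) : x <= y -> z <= t -> x + z <= y + t.
Proof.
move=> xy zt; apply: le_trans (lev_add2r z _ _ xy) _.
by rewrite ![y + _]addrC; apply: lev_add2r.
Qed.

Lemma levBlDr E (x y z : E) : (x - y <= z) = (x <= z + y).
Proof. by rewrite -[LHS]subv_ge0 -[RHS]subv_ge0 opprB addrA addrAC. Qed.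

Lemma levBrDr E (x y z : E) : (x <= y - z) = (x + z <= y).
Proof. by rewrite -[LHS]subv_ge0 -[RHS]subv_ge0 opprD addrA addrAC. Qed.

Lemma levN2 E (x y : E) : (- x <= - y) = (y <= x).
Proof. by rewrite -[LHS]subv_ge0 -[RHS]subv_ge0 opprK addrC. Qed.

Lemma levD2r E (z x y : E) : (x + z <= y + z) = (x <= y).
Proof. by rewrite -levBrDr addrK. Qed.

Lemma sumv_ge0 E (I : Type) (r : seq I) (P : pred I) (f : I -> E) :
  (forall n, P n -> 0 <= f n) -> 0 <= \sum_(n <- r | P n) f n.
Proof. by move=> f0; elim/big_ind: _ => // x y; apply: addv_ge0. Qed.

Lemma lev_sum E (I : Type) (r : seq I) (P : pred I) (f g : I -> E) :
  (forall n, P n -> f n <= g n) ->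
  \sum_(n <- r | P n) f n <= \sum_(n <- r | P n) g n.
Proof.
move=> fg; rewrite -subv_ge0 -sumrB; apply: sumv_ge0 => n Pn.
by rewrite subv_ge0 fg.
Qed.

Lemma sup2P E (x y z : E) : supremums [set x; y] z <->
  [/\ x <= z, y <= z & forall w, x <= w -> y <= w -> z <= w].
Proof.
split=> [[zub zl]|[xz yz zl]].
  split; [by apply: zub; left|by apply: zub; right|].
  by move=> w xw yw; apply: zl => _ [->|->].
split=> [_ [->|->]//|w wub].
by apply: zl; apply: wub; [left|right].
Qed.

Lemma inf2P E (x y z : E) : infimums [set x; y] z <->
  [/\ z <= x, z <= y & forall w, w <= x -> w <= y -> w <= z].
Proof.
split=> [[zlb zl]|[xz yz zl]].
  split; [by apply: zlb; left|by apply: zlb; right|].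
  by move=> w xw yw; apply: zl => _ [->|->].
split=> [_ [->|->]//|w wlb].
by apply: zl; apply: wlb; [left|right].
Qed.

Lemma inf2_sup2N E (x y z : E) :
  infimums [set x; y] z <-> supremums [set - x; - y] (- z).
Proof.
split=> [/inf2P[zx zy zl]|/sup2P]; last first.
  rewrite !levN2 => -[zx zy zl]; apply/inf2P; split=> // w wx wy.
  by rewrite -levN2; apply: zl; rewrite levN2.
apply/sup2P; rewrite !levN2; split=> // w; rewrite -[w]opprK !levN2.
exact: zl.
Qed.

(** Translating by [y] turns the supremum of [x - y] and [0] into that of [x]
    and [y]; negation turns suprema into infima. *)
Lemma pos_part_is_riesz E :
  (forall x : E, exists z, supremums [set x; 0] z) -> is_riesz E.
Proof.
move=> pos; have sup x y : exists z : E, supremums [set x; y] z.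
  have [z /sup2P[xz z0 zl]] := pos (x - y); exists (z + y).
  apply/sup2P; split=> [||w xw yw].
  - by rewrite -levBlDr.
  - by rewrite -subv_ge0 addrK.
  - by rewrite -levBrDr; apply: zl; rewrite ?subv_ge0 ?levD2r.
move=> x y; split=> //; have [z zsup] := sup (- x) (- y).
by exists (- z); apply/inf2_sup2N; rewrite opprK.
Qed.

Lemma linear_subspaceN E (A : set E) x : linear_subspace A -> A x -> A (- x).
Proof. by move=> [A0 lA] Ax; rewrite -scaleN1r -[_ *: x]addr0; apply: lA. Qed.

Lemma linear_subspaceD E (A : set E) x y :
  linear_subspace A -> A x -> A y -> A (x + y).
Proof. by move=> [A0 lA] Ax Ay; rewrite -[x]scale1r; apply: lA. Qed.

Lemma sup_closed_sublattice E (A : set E) : linear_subspace A ->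
  (forall x y z, A x -> A y -> supremums [set x; y] z -> A z) ->
  vector_sublattice A.
Proof.
move=> lA supA; split=> // x y z Ax Ay [/supA|/inf2_sup2N/supA]; first by apply.
move=> Az; rewrite -[z]opprK; apply: linear_subspaceN => //.
by apply: Az; apply: linear_subspaceN.
Qed.

Lemma order_dense_ge E (A : set E) (y w : E) : order_dense A ->
  (forall x, A x -> y <= x -> w <= x) -> w <= y.
Proof. by move=> dA wl; apply: (dA y).2 => x [Ax yx]; apply: wl. Qed.

(** Without a majorant of [y] in [A], order density would make [y] the infimum
    of the empty set, hence the greatest element; then [y + y <= y], so that
    [0], which lies in [A], is a majorant after all. *)
Lemma order_dense_majorant E (A : set E) (y : E) :
  A 0 -> order_dense A -> exists2 x, A x & y <= x.
Proof.
move=> A0 dA; apply: contrapT => nx.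
have top w : w <= y.
  by apply: order_dense_ge dA _ => x Ax yx; case: nx; exists x.
apply: nx; exists 0 => //; rewrite -[0](subrr y) levBrDr; exact: top.
Qed.

End OrderedVectorSpaces.

(** * Operators on eventually constant sequences *)

Section OperatorsOnLinf0.
Context {R : realDomainType}.
Implicit Types E G : rieszType R.

Fact regop_linear E G (T : regop E G) : linear T.
Proof.
case: T => f /= /asboolP[S1 [S2 [_ _ Sf]]] a x y.
rewrite !Sf (linearP S1) (linearP S2).
by rewrite scalerBr opprD addrACA.
Qed.

HB.instance Definition _ E G (T : regop E G) :=
  GRing.isLinear.Build R E G *:%R T (regop_linear T).

Definition stable_from (x : linf0 R) N := forall n, (N <= n)%N -> x n = x N.

Lemma stable_fromW x M N : (M <= N)%N -> stable_from x M -> stable_from x N.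
Proof.
by move=> MN xM n Nn; rewrite xM ?(leq_trans MN)// [RHS]xM.
Qed.

Definition stable_index (x : linf0 R) : nat := sval (cid (asboolW (valP x))).

Lemma stable_indexP x : stable_from x (stable_index x).
Proof. exact: (svalP (cid (asboolW (valP x)))). Qed.

Fact tail_seq_ev_const N :
  ev_const_pred (fun n => (N <= n)%:R : R).
Proof.
by apply/asboolP; exists N => n Nn; rewrite Nn leqnn.
Qed.

(** In particular [tail_seq 0] is the constant sequence 1. *)
Definition tail_seq N : linf0 R := Linf0 (tail_seq_ev_const N).

Lemma linf0_sumE (I : Type) (r : seq I) (P : pred I) (f : I -> linf0 R) k :
  (\sum_(i <- r | P i) f i) k = \sum_(i <- r | P i) f i k.
Proof. exact: (big_morph (fun x : linf0 R => x k)). Qed.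

(** The decomposition has nonnegative coefficients when [x] is nonnegative, so
    that positivity of operators need only be tested on unit and tail
    sequences. *)
Lemma linf0_expand (x : linf0 R) N : stable_from x N ->
  x = \sum_(n < N) x n *: unit_seq R n + x N *: tail_seq N.
Proof.
move=> xN; apply/val_inj/funext => k; rewrite -[LHS]/(x k).
rewrite [RHS](_ : _ = (\sum_(n < N) x n *: unit_seq R n) k +
  x N * (N <= k)%:R)//.
rewrite linf0_sumE.
rewrite (eq_bigr (fun n : 'I_N => x n * (k == n)%:R))//.
have [Nk|kN] := leqP N k.
  rewrite big1 ?add0r ?mulr1 ?xN// => n _.
  by rewrite gtn_eqF ?mulr0// (leq_trans (ltn_ord n)).
rewrite mulr0 addr0 (bigD1 (Ordinal kN))//= eqxx mulr1 big1 ?addr0// => n.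
by rewrite -val_eqE/= eq_sym => /negPf->; rewrite mulr0.
Qed.

Lemma stable_tail_seq N : stable_from (tail_seq N) N.
Proof. by move=> n Nn; rewrite /= Nn leqnn. Qed.

Lemma tail_seq0 N :
  tail_seq N = tail_seq 0 - \sum_(n < N) unit_seq R n.
Proof.
apply/eqP; rewrite eq_sym subr_eq addrC; apply/eqP.
have st : stable_from (tail_seq 0) N.
  exact: stable_fromW (leq0n N) (@stable_tail_seq 0).
rewrite {1}(linf0_expand st) /= scale1r; congr (_ + _).
by apply: eq_bigr => n _; rewrite scale1r.
Qed.

Lemma unit_seq_ge0 n : 0 <= unit_seq R n.
Proof. by apply/asboolP => k /=; rewrite ler0n. Qed.

Lemma tail_seq_ge0 N : 0 <= tail_seq N.
Proof. by apply/asboolP => k /=; rewrite ler0n. Qed.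

Lemma linf0_ge0 (x : linf0 R) : 0 <= x -> forall n, 0 <= (x n : R).
Proof. by move=> /asboolP. Qed.

Section Coordinates.
Context {G : rieszType R}.
Implicit Types S T : regop (linf0 R) G.

Lemma regop_tail_seq T N :
  T (tail_seq N) = T (tail_seq 0) - \sum_(n < N) T (unit_seq R n).
Proof. by rewrite tail_seq0 linearB linear_sum. Qed.

Lemma regop_leP S T :
  S <= T <-> (forall n, S (unit_seq R n) <= T (unit_seq R n)) /\
             (forall N, S (tail_seq N) <= T (tail_seq N)).
Proof.
split=> [/asboolP ST|[STe STt]].
  by split=> n; apply: ST; [exact: unit_seq_ge0|exact: tail_seq_ge0].
apply/asboolP => x /linf0_ge0 x0; rewrite (linf0_expand (@stable_indexP x)).
rewrite !linearD !linear_sum !linearZ; apply: levD.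
  apply: lev_sum => n _; rewrite !linearZ.
  by apply: lev_scale2l; [exact: x0|exact: STe].
by apply: lev_scale2l; [exact: x0|exact: STt].
Qed.

Lemma regop_ext S T : (forall n, S (unit_seq R n) = T (unit_seq R n)) ->
  S (tail_seq 0) = T (tail_seq 0) -> S = T.
Proof.
move=> STe STt.
have STN N : S (tail_seq N) = T (tail_seq N).
  rewrite (regop_tail_seq S) (regop_tail_seq T) STt; congr (_ - _).
  exact: eq_bigr.
by apply/eqP; rewrite eq_le; apply/andP; split; apply/regop_leP; split=> n;
  rewrite ?STe ?STN.
Qed.

Variables (t : nat -> G) (c : G).

(** The operator with values [t n] at the unit sequences and [c] at the constant
    sequence 1. The chosen index depends on [x], which is harmless since every
    index from which [x] is constant gives the same value
    ([op_of_coordsE]). *)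
Definition op_of_coords (x : linf0 R) : G :=
  let N := stable_index x in
  \sum_(n < N) x n *: t n + x N *: (c - \sum_(n < N) t n).

Lemma op_of_coordsE x N : stable_from x N -> op_of_coords x =
  \sum_(n < N) x n *: t n + x N *: (c - \sum_(n < N) t n).
Proof.
pose g N := \sum_(n < N) x n *: t n + x N *: (c - \sum_(n < N) t n).
have gS M : x M.+1 = x M -> g M.+1 = g M.
  move=> xM; rewrite /g !big_ord_recr/= xM opprD addrA [_ - t M]addrC.
  by rewrite scalerDr scalerN addrA addrK.
have gD M k : stable_from x M -> g (M + k)%N = g M.
  move=> xM; elim: k => [|k <-]; first by rewrite addn0.
  by rewrite addnS gS// xM ?[RHS]xM// ?leq_addr// -addnS leq_addr.
have gE M : stable_from x M -> g M = g (stable_index x).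
  move=> xM; rewrite -(gD M (stable_index x))// addnC gD//.
  exact: stable_indexP.
by move=> xN; rewrite -/(g N) gE.
Qed.

Fact op_of_coords_linear : linear op_of_coords.
Proof.
move=> a x y; pose N := maxn (stable_index x) (stable_index y).
have xN : stable_from x N.
  exact: stable_fromW (leq_maxl _ _) (@stable_indexP x).
have yN : stable_from y N.
  exact: stable_fromW (leq_maxr _ _) (@stable_indexP y).
have pE n : (a *: x + y) n = a * x n + y n by [].
have zN : stable_from (a *: x + y) N.
  by move=> n Nn; rewrite !pE xN// yN.
rewrite (op_of_coordsE xN) (op_of_coordsE yN) (op_of_coordsE zN) pE.
rewrite scalerDl -scalerA [a *: (\sum_(n < N) _ + _)]scalerDr addrACA.
rewrite scaler_sumr -big_split/=.
by congr (_ + _); apply: eq_bigr => n _; rewrite scalerA -scalerDl.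
Qed.

HB.instance Definition _ :=
  GRing.isLinear.Build R (linf0 R) G *:%R op_of_coords op_of_coords_linear.

Lemma op_of_coords_unit n : op_of_coords (unit_seq R n) = t n.
Proof.
have st : stable_from (unit_seq R n) n.+1.
  by move=> m nm; rewrite /= !gtn_eqF.
rewrite (op_of_coordsE st) /= gtn_eqF// scale0r addr0 big_ord_recr/= eqxx.
rewrite scale1r big1 ?add0r// => m _.
by rewrite ltn_eqF// scale0r.
Qed.

Lemma op_of_coords_one : op_of_coords (tail_seq 0) = c.
Proof.
by rewrite (op_of_coordsE (@stable_tail_seq 0)) !big_ord0 subr0 add0r/= scale1r.
Qed.

Lemma op_of_coords_ge0 : (forall n, 0 <= t n) ->
  (forall N, \sum_(n < N) t n <= c) -> positive_op op_of_coords.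
Proof.
move=> t0 tc x /linf0_ge0 x0; apply: addv_ge0.
  by apply: sumv_ge0 => n _; apply: scalev_ge0 => //; exact: x0.
by apply: scalev_ge0; [exact: x0|rewrite subv_ge0].
Qed.

End Coordinates.

(** The hypotheses make positive both the operator with coordinates [p] and
    [a] and what is left of it after subtracting the one with coordinates [t]
    and [c]. *)
Lemma op_of_coords_regular G (t p : nat -> G) (c a : G) :
  (forall n, 0 <= p n) -> (forall n, t n <= p n) ->
  (forall N, \sum_(n < N) p n <= a) ->
  (forall N, \sum_(n < N) (p n - t n) <= a - c) ->
  regular_pred (op_of_coords t c).
Proof.
move=> p0 tp pa qa; apply/asboolP.
exists (op_of_coords p a), (op_of_coords (fun n => p n - t n) (a - c)); split.
- exact: op_of_coords_ge0.
- by apply: op_of_coords_ge0 => // n; rewrite subv_ge0.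
move=> x; rewrite /op_of_coords; set N := stable_index x.
rewrite opprD addrACA -sumrB -scalerBr; congr (_ + _).
  by apply: eq_bigr => n _; rewrite -scalerBr opprB addrCA subrr addr0.
congr (_ *: _); rewrite sumrB !opprB addrA [a - _ + (_ - _)]addrA subrK.
by rewrite [c - a]addrC addrACA subrr add0r addrC.
Qed.

Lemma regop_of_coords G (t p : nat -> G) (c a : G) :
  (forall n, 0 <= p n) -> (forall n, t n <= p n) ->
  (forall N, \sum_(n < N) p n <= a) ->
  (forall N, \sum_(n < N) (p n - t n) <= a - c) ->
  exists S : regop (linf0 R) G,
    (forall n, S (unit_seq R n) = t n) /\ S (tail_seq 0) = c.
Proof.
move=> p0 tp pa qa; exists (RegOp (op_of_coords_regular p0 tp pa qa)).
by split=> [n|]; [exact: op_of_coords_unit|exact: op_of_coords_one].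
Qed.

Lemma lev_partial_sum G (d : nat -> G) M N : (forall n, 0 <= d n) ->
  (M <= N)%N -> \sum_(n < M) d n <= \sum_(n < N) d n.
Proof.
move=> d0 /subnKC<-; elim: (N - M)%N => [|k IH]; first by rewrite addn0.
by rewrite addnS big_ord_recr/= -[leLHS]addr0; apply: levD.
Qed.

(** Since [U] dominates [d] on unit sequences, adding the inequalities for the
    indices from [N] up to a large [M] bounds the block of [d] by the value of
    [U] at a piece of [tail_seq N]. This makes the positive part constructed in
    [spaceH_pos_part] the least one. *)
Lemma partial_sum_le_tail G (U : regop (linf0 R) G) (d : nat -> G) M N :
  0 <= U -> (forall n, 0 <= d n) -> (forall n, d n <= U (unit_seq R n)) ->
  \sum_(n < M) d n <= \sum_(n < N) d n + U (tail_seq N).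
Proof.
move=> /regop_leP[_ U0] d0 dU; rewrite regop_tail_seq addrCA -levBlDr.
have {U0} : 0 <= U (tail_seq (M + N)) := U0 _.
rewrite regop_tail_seq subv_ge0; apply: le_trans.
(* The index M + N exceeds both M and N, which need not be compared. *)
rewrite opprB -sumrB.
have -> : \sum_(n < M + N) U (unit_seq R n) =
    \sum_(n < M + N) d n + \sum_(n < M + N) (U (unit_seq R n) - d n).
  by rewrite -big_split/=; apply: eq_bigr => n _; rewrite addrC subrK.
apply: levD; first by apply: lev_partial_sum => //; exact: leq_addr.
apply: (lev_partial_sum (d := fun n => U (unit_seq R n) - d n)).
  by move=> n; rewrite subv_ge0.
exact: leq_addl.
Qed.

End OperatorsOnLinf0.

(** * Positive parts in the space of operators *)

Section RieszSpaceH.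
Context {R : realDomainType} {F Fs : rieszType R} {i : {linear F -> Fs}}.
Implicit Types T U P : spaceH i.

Lemma spaceH_leP T U :
  T <= U <-> (forall n, T (unit_seq R n) <= U (unit_seq R n)) /\
             (forall N, T (tail_seq N) <= U (tail_seq N)).
Proof. exact: regop_leP. Qed.

Lemma spaceHD T U x : (T + U) x = T x + U x.
Proof. by []. Qed.

Lemma spaceHB T U x : (T - U) x = T x - U x.
Proof. by []. Qed.

Lemma spaceHZ (a : R) T x : (a *: T) x = a *: T x.
Proof. by []. Qed.

Lemma spaceH_range T n : range i (T (unit_seq R n)).
Proof. by have /asboolP := valP T. Qed.

Lemma spaceH_ext T U : (forall n, T (unit_seq R n) = U (unit_seq R n)) ->
  T (tail_seq 0) = U (tail_seq 0) -> T = U.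
Proof. by move=> Te T1; apply/val_inj/regop_ext. Qed.

(** Here [a] and [b] are the sums of the series of negative and of positive
    parts of the values of [T] at the unit sequences. For an operator [U] above
    both [T] and 0, the operators [U] and [U - T] are positive, so that their
    values at the constant sequence 1 are at least [b] and [a]: this forces the
    value of the least such [U] there. *)
Lemma spaceH_pos_part T P (a b : Fs) :
  (forall n, supremums [set T (unit_seq R n); 0] (P (unit_seq R n))) ->
  supremums
    (range (fun N => \sum_(n < N) (P (unit_seq R n) - T (unit_seq R n)))) a ->
  supremums (range (fun N => \sum_(n < N) P (unit_seq R n))) b ->
  supremums [set T (tail_seq 0) + a; b] (P (tail_seq 0)) ->
  supremums [set T; 0] P.
Proof.
move=> Pe [aub al] [bub bl] /sup2P[aP bP P1].
have TP n : T (unit_seq R n) <= P (unit_seq R n) by case/sup2P: (Pe n).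
have P0 n : 0 <= P (unit_seq R n) by case/sup2P: (Pe n).
have Pl n w : T (unit_seq R n) <= w -> 0 <= w -> P (unit_seq R n) <= w.
  by case/sup2P: (Pe n) => _ _; apply.
apply/sup2P; split.
- apply/spaceH_leP; split=> // N.
  rewrite (regop_tail_seq T) (regop_tail_seq P) levBrDr addrAC -addrA -sumrB.
  apply: le_trans aP; rewrite addrC [leRHS]addrC levD2r; apply: aub.
  by exists N.
- apply/spaceH_leP; split=> // N.
  rewrite (regop_tail_seq P) subv_ge0.
  by apply: le_trans bP; apply: bub; exists N.
move=> U TU U0; have [TUe _] := (spaceH_leP _ _).1 TU.
have [U0e _] := (spaceH_leP _ _).1 U0.
have PU n : P (unit_seq R n) <= U (unit_seq R n) by exact: Pl (TUe n) (U0e n).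
apply/spaceH_leP; split=> // N.
rewrite (regop_tail_seq P) levBlDr addrC; apply: P1; last first.
  by apply: bl => _ [M _ <-]; exact: (partial_sum_le_tail M N U0 P0 PU).
rewrite [leLHS]addrC -levBrDr; apply: al => _ [M _ <-].
have UT0 : 0 <= (U : regop _ _) - (T : regop _ _) by rewrite subv_ge0.
have dP n : 0 <= P (unit_seq R n) - T (unit_seq R n) by rewrite subv_ge0.
apply: le_trans (partial_sum_le_tail M N UT0 dP _) _.
  by move=> n; apply: lev_add2r.
rewrite [X in _ + X](_ : _ = U (tail_seq N) - T (tail_seq N))//.
by rewrite (regop_tail_seq T) sumrB opprB addrACA addKr.
Qed.

Fact limit_op_regular (z : Fs) : regular_pred (op_of_coords (fun=> 0) z).
Proof.
have [a [b [a0 b0 zE]]] := riesz_directed z.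
apply: (@op_of_coords_regular _ _ _ (fun=> 0) _ a) => // N.
  by rewrite sumr_const mul0rn.
by rewrite subrr sumr_const mul0rn zE opprB addrCA subrr addr0.
Qed.

Fact limit_op_spaceH (z : Fs) : spaceH_pred i (RegOp (limit_op_regular z)).
Proof.
by apply/asboolP => n; exists 0; rewrite // linear0 [RHS]op_of_coords_unit.
Qed.

(** The operators vanishing on the unit sequences are the multiples of the
    limit functional: [limit_op z] sends [x] to the limit of [x] times [z].
    They copy the lattice structure of [Fs] inside the space of operators. *)
Definition limit_op (z : Fs) : spaceH i := SpaceH (limit_op_spaceH z).

Lemma limit_op_unit z n : limit_op z (unit_seq R n) = 0.
Proof. exact: op_of_coords_unit. Qed.

Lemma limit_op_tail z N : limit_op z (tail_seq N) = z.
Proof.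
rewrite (regop_tail_seq (limit_op z)) big1 ?subr0; last first.
  by move=> n _; exact: limit_op_unit.
exact: op_of_coords_one.
Qed.

Fact limit_op_linear : linear limit_op.
Proof.
move=> a x y; apply: spaceH_ext => [n|].
  by rewrite spaceHD spaceHZ !limit_op_unit scaler0 addr0.
by rewrite spaceHD spaceHZ !limit_op_tail.
Qed.

HB.instance Definition _ :=
  GRing.isLinear.Build R Fs (spaceH i) *:%R limit_op limit_op_linear.

Lemma limit_op_sup x y z : supremums [set x; y] z ->
  supremums [set limit_op x; limit_op y] (limit_op z).
Proof.
move=> /sup2P[xz yz zl]; apply/sup2P; split=> [||U xU yU].
- by apply/spaceH_leP; split=> n; rewrite ?limit_op_unit ?limit_op_tail.
- by apply/spaceH_leP; split=> n; rewrite ?limit_op_unit ?limit_op_tail.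
have [xUe xUt] := (spaceH_leP _ _).1 xU.
have [_ yUt] := (spaceH_leP _ _).1 yU.
apply/spaceH_leP; split=> n.
  by have := xUe n; rewrite !limit_op_unit.
by rewrite limit_op_tail; apply: zl;
  [have := xUt n|have := yUt n]; rewrite limit_op_tail.
Qed.

End RieszSpaceH.

(** * Operators with values in F *)

Section Embedding.
Context {R : realDomainType} {F Fs : rieszType R} (i : {linear F -> Fs}).
Hypothesis i_ge0 : bipositive i.

Lemma bipositive_le x y : (i x <= i y) <-> (x <= y).
Proof. by rewrite -(subv_ge0 x) -(subv_ge0 (i x)) -linearB; split=> /i_ge0. Qed.

Fact embed_regular (T : regop (linf0 R) F) : regular_pred (i \o T).
Proof.
case: T => f /= /asboolP[S1 [S2 [p1 p2 fE]]]; apply/asboolP.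
exists (i \o S1), (i \o S2); split=> x /=.
- by move=> /p1 /i_ge0.
- by move=> /p2 /i_ge0.
- by rewrite fE linearB.
Qed.

Fact embed_spaceH T : spaceH_pred i (RegOp (embed_regular T)).
Proof. by apply/asboolP => n; exists (T (unit_seq R n)). Qed.

Definition embed (T : regop (linf0 R) F) : spaceH i := SpaceH (embed_spaceH T).

Lemma embedE T x : embed T x = i (T x).
Proof. by []. Qed.

Fact embed_linear : linear embed.
Proof.
move=> a S T; apply: spaceH_ext => [n|].
  by rewrite spaceHD spaceHZ !embedE -linearP.
by rewrite spaceHD spaceHZ !embedE -linearP.
Qed.

HB.instance Definition _ :=
  GRing.isLinear.Build R (regop (linf0 R) F) (spaceH i) *:%R embed embed_linear.

Lemma embed_bipositive : bipositive embed.
Proof.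
move=> T; split=> [/asboolP T0|/asboolP T0]; apply/asboolP => x x0.
  by apply/i_ge0; exact: T0.
by apply/i_ge0; exact: T0.
Qed.

End Embedding.

(** * The Riesz completion *)

Section Completion.
Context {R : realDomainType} {F Fs : rieszType R} {i : {linear F -> Fs}}.
Hypothesis hFs : seq_order_closure i.

Let i_ge0 : bipositive i := soc_bipositive hFs.
Let i_le x y : (i x <= i y) <-> (x <= y) := bipositive_le i_ge0 x y.

Lemma soc_majorant (y : Fs) : exists x, y <= i x.
Proof.
have [||_ [x _ <-] yx] := @order_dense_majorant _ _ (range i) y.
- by exists 0; rewrite // linear0.
- exact: soc_dense hFs.
by exists x.
Qed.

(** The supremum in [Fs] lies in the image of [i], since that is a sublattice,
    and it cannot be smaller than the supremum taken in [F]. *)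
Lemma soc_sup2 x y z :
  supremums [set x; y] z -> supremums [set i x; i y] (i z).
Proof.
move=> /sup2P[xz yz zl]; have [[s ssup] _] := riesz_lattice (i x) (i y).
have [w _ wE] : range i s.
  have [_] := soc_sublattice hFs; apply; last by left; exact: ssup.
  - by exists x.
  - by exists y.
move/sup2P: ssup; rewrite -wE => -[/i_le xw /i_le yw wl].
apply/sup2P; split; [exact/i_le|exact/i_le|move=> u xu yu].
by apply: le_trans (wl _ xu yu); apply/i_le/zl.
Qed.

Lemma soc_series_sup (d : nat -> F) (a : F) : (forall n, 0 <= d n) ->
  (forall N, \sum_(n < N) d n <= a) ->
  exists b, supremums (range (fun N => \sum_(n < N) i (d n))) b.
Proof.
move=> d0 da; have [||b [[_ bub] bl]] := @soc_complete _ _ _ _ hFs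
  (fun N => \sum_(n < N) d n).
- by move=> M N; apply: lev_partial_sum.
- by exists a => _ [N _ <-].
have uE : i \o (fun N => \sum_(n < N) d n) = (fun N => \sum_(n < N) i (d n)).
  by apply/funext => N /=; rewrite linear_sum.
rewrite uE in bub bl; exists b; split=> // w wub; exact: bl.
Qed.

(** The elements [a1] and [a2] of [F] come from majorants of the values at the
    constant sequence 1 of two positive operators with difference [T]: the
    first dominates the positive parts [p n], the second the negative parts
    [p n - f n]. *)
Lemma spaceH_coords (T : spaceH i) : exists f p : nat -> F, exists a1 a2 : F,
  [/\ forall n, T (unit_seq R n) = i (f n),
      forall n, supremums [set f n; 0] (p n),
      forall N, \sum_(n < N) p n <= a1 &
      forall N, \sum_(n < N) (p n - f n) <= a2].
Proof.
have /choice[f fE] n : exists x, T (unit_seq R n) = i x.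
  by have [x _ <-] := spaceH_range T n; exists x.
have /choice[p pE] n := (riesz_lattice (f n) 0).1.
have /asboolP[S1 [S2 [S10 S20 TE]]] := valP (spaceH_op T).
have S_sum (S : {linear linf0 R -> Fs}) N : positive_op S ->
    \sum_(n < N) S (unit_seq R n) <= S (tail_seq 0).
  move=> S0; rewrite -linear_sum -subv_ge0 -linearB -tail_seq0.
  exact/S0/tail_seq_ge0.
have [a1 S1a] := soc_majorant (S1 (tail_seq 0)).
have [a2 S2a] := soc_majorant (S2 (tail_seq 0)).
have fS n : i (f n) = S1 (unit_seq R n) - S2 (unit_seq R n) by rewrite -fE TE.
have pS n : i (p n) <= S1 (unit_seq R n).
  have /sup2P[_ _] := soc_sup2 (pE n); apply.
    rewrite fS levBlDr -{1}[S1 _]addr0 ![S1 _ + _]addrC levD2r.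
    exact/S20/unit_seq_ge0.
  by rewrite linear0; apply/S10/unit_seq_ge0.
exists f, p, a1, a2; split=> // N; apply/i_le; rewrite linear_sum.
  apply: le_trans S1a; apply: le_trans (S_sum S1 N S10).
  by apply: lev_sum => n _.
apply: le_trans S2a; apply: le_trans (S_sum S2 N S20).
by apply: lev_sum => n _; rewrite linearB fS levBlDr addrC subrK.
Qed.

Lemma spaceH_riesz : is_riesz (spaceH i).
Proof.
apply: pos_part_is_riesz => T.
have [f [p [a1 [a2 [fE pE pa qa]]]]] := spaceH_coords T.
have p0 n : 0 <= p n by case/sup2P: (pE n).
have q0 n : 0 <= p n - f n by rewrite subv_ge0; case/sup2P: (pE n).
have [b bsup] := soc_series_sup p0 pa.
have [a asup] := soc_series_sup q0 qa.
have [[c csup] _] := riesz_lattice (T (tail_seq 0) + a) b.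
have ip0 n : 0 <= i (p n) by apply/i_ge0.
have bc : b <= c by case/sup2P: csup.
have [] := @regop_of_coords _ _ (fun n => i (p n)) (fun n => i (p n)) c c.
- by [].
- by [].
- by move=> N; apply: le_trans bc; apply: bsup.1; exists N.
- by move=> N; rewrite subrr big1// => n _; rewrite subrr.
move=> P [Pe P1].
have PH : spaceH_pred i P by apply/asboolP => n; rewrite Pe; exists (p n).
exists (SpaceH PH); apply: (@spaceH_pos_part _ _ _ _ T (SpaceH PH) a b) => /=.
- by move=> n; rewrite Pe fE -(linear0 i); apply: soc_sup2.
- rewrite (_ : (fun N => _) = (fun N => \sum_(n < N) i (p n - f n)))//.
  by apply/funext => N; apply: eq_bigr => n _; rewrite Pe fE linearB.
- rewrite (_ : (fun N => _) = (fun N => \sum_(n < N) i (p n)))//.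
  by apply/funext => N; apply: eq_bigr => n _; rewrite Pe.
- by rewrite P1.
Qed.

(** The value at the constant sequence 1 does not affect regularity, because the
    bounds [a1] and [a2] only concern the values at the unit sequences. It may
    thus be moved into [F] at the cost of a multiple of the limit. *)
Lemma spaceH_change_limit (T : spaceH i) (s : F) :
  exists S : regop (linf0 R) F,
    T = embed i_ge0 S + limit_op (T (tail_seq 0) - i s).
Proof.
have [f [p [a1 [a2 [fE pE pa qa]]]]] := spaceH_coords T.
have p0 n : 0 <= p n by case/sup2P: (pE n).
have fp n : f n <= p n by case/sup2P: (pE n).
have [[a /sup2P[a1a a2a _]] _] := riesz_lattice a1 (a2 + s).
have [||S [Se S1]] := @regop_of_coords _ _ f p s a p0 fp.
- by move=> N; apply: le_trans a1a.
- by move=> N; apply: (le_trans (qa N)); rewrite levBrDr.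
exists S; apply: spaceH_ext => [n|].
  by rewrite spaceHD limit_op_unit addr0 embedE Se.
by rewrite spaceHD limit_op_tail embedE S1 addrC subrK.
Qed.

Lemma limit_op_embed x :
  exists S : regop (linf0 R) F, embed i_ge0 S = limit_op (i x).
Proof.
have [S SE] := spaceH_change_limit (limit_op (i x)) x; exists S.
by rewrite SE limit_op_tail subrr linear0 addr0.
Qed.

Lemma limit_op_le x y : (limit_op (i := i) x <= limit_op y) <-> (x <= y).
Proof.
split=> [/spaceH_leP[_ /(_ 0)]|xy]; first by rewrite !limit_op_tail.
by apply/spaceH_leP; split=> n; rewrite ?limit_op_unit ?limit_op_tail.
Qed.

(** The majorants of [T] used are those that agree with [T] on the unit
    sequences and have a value [i s] at the constant sequence 1; the infimum of
    these values is that of [T] by order density of [F] in [Fs]. *)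
Lemma embed_dense : order_dense (range (embed i_ge0)).
Proof.
move=> T; split=> [_ [_ /=]//|U Ulb].
have {}Ulb s : T (tail_seq 0) <= i s ->
    U <= T + limit_op (i s - T (tail_seq 0)).
  move=> Ts; have [S ST] := spaceH_change_limit T s.
  have SE : embed i_ge0 S = T + limit_op (i s - T (tail_seq 0)).
    by rewrite {1}ST -(opprB (T (tail_seq 0))) linearN addrK.
  rewrite -SE; apply: Ulb; split; first by exists S.
  rewrite /= SE -{1}[T]addr0 ![T + _]addrC levD2r -(linear0 limit_op).
  by apply/limit_op_le; rewrite subv_ge0.
have UTt N s : T (tail_seq 0) <= i s ->
    U (tail_seq N) <= T (tail_seq N) + (i s - T (tail_seq 0)).
  move=> /Ulb/spaceH_leP[_ /(_ N)].
  by rewrite spaceHD limit_op_tail.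
apply/spaceH_leP; split=> [n|N].
  have [s /Ulb/spaceH_leP[/(_ n) + _]] := soc_majorant (T (tail_seq 0)).
  by rewrite spaceHD limit_op_unit addr0.
have : U (tail_seq N) - T (tail_seq N) + T (tail_seq 0) <= T (tail_seq 0).
  apply: (order_dense_ge (soc_dense hFs)) => _ [s _ <-] Ts.
  by rewrite -levBrDr levBlDr addrC; exact: UTt.
by rewrite -levBrDr subrr levBlDr add0r.
Qed.

(** An operator with the increments of [u] as values at the unit sequences sees,
    through its positive part, the supremum of the partial sums of these
    increments, which is that of [u] up to the first term. *)
Lemma limit_op_sup_seq (B : set (spaceH i)) (u : nat -> F) (v : F) (z : Fs) :
  vector_sublattice B -> range (embed i_ge0) `<=` B ->
  increasing u -> ubound (range u) v -> supremums (range (i \o u)) z ->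
  B (limit_op (z - i (u 0))).
Proof.
move=> [linB supB] embB uincr uv [zub zl].
pose d n := u n.+1 - u n.
have d_sum N : \sum_(n < N) d n = u N - u 0.
  by rewrite -(big_mkord xpredT d) telescope_sumr.
have d0 n : 0 <= d n by rewrite subv_ge0; apply: uincr.
have [||||S [Se S1]] := @regop_of_coords _ _ d d (v - u 0) (v - u 0).
- exact: d0.
- by [].
- by move=> N; rewrite d_sum; apply: lev_add2r; apply: uv; exists N.
- by move=> N; rewrite subrr big1// => n _; rewrite subrr.
(* T keeps the increments and vanishes at the constant sequence 1, while P,
   which will be its positive part, has there the value z - i (u 0). *)
pose T : spaceH i := embed i_ge0 S - limit_op (i (v - u 0)).
pose P : spaceH i := T + limit_op (z - i (u 0)).
have Te n : T (unit_seq R n) = i (d n).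
  by rewrite spaceHB limit_op_unit subr0 embedE Se.
have T1 : T (tail_seq 0) = 0.
  by rewrite spaceHB limit_op_tail embedE S1 subrr.
have Pe n : P (unit_seq R n) = i (d n).
  by rewrite spaceHD limit_op_unit addr0 Te.
have P1 : P (tail_seq 0) = z - i (u 0).
  by rewrite spaceHD limit_op_tail T1 add0r.
have uz : 0 <= z - i (u 0) by rewrite subv_ge0; apply: zub; exists 0.
have PT : supremums [set T; 0] P.
  apply: (@spaceH_pos_part _ _ _ _ T P 0 (z - i (u 0))).
  - move=> n; rewrite Te Pe; apply/sup2P; split=> //; exact/i_ge0.
  - have dE N : \sum_(n < N) (P (unit_seq R n) - T (unit_seq R n)) = 0.
      by apply: big1 => n _; rewrite Te Pe subrr.
    split=> [_ [N _ <-]|w wub]; first by rewrite dE.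
    by rewrite -(dE 0); apply: wub; exists 0.
  - have dE N : \sum_(n < N) P (unit_seq R n) = i (u N) - i (u 0).
      rewrite -linearB -d_sum linear_sum; apply: eq_bigr => n _; exact: Pe.
    split=> [_ [N _ <-]|w wub].
      by rewrite dE; apply: lev_add2r; apply: zub; exists N.
    rewrite levBlDr; apply: zl => _ [N _ <-] /=.
    by rewrite -levBlDr -dE; apply: wub; exists N.
  - by rewrite T1 P1 addr0; apply/sup2P.
have BT : B T.
  apply: linear_subspaceD => //; first by apply: embB; exists S.
  apply: linear_subspaceN => //.
  by have [S' <-] := limit_op_embed (v - u 0); apply: embB; exists S'.
have BP : B P by apply: supB BT linB.1 _; left; exact: PT.
rewrite (_ : limit_op _ = P - T); last by rewrite /P [T + _]addrC addrK.
by apply: linear_subspaceD => //; apply: linear_subspaceN.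
Qed.

(** The elements whose multiple of the limit lies in [B] form a sublattice to
    which the minimality of the sequential order closure applies. *)
Lemma embed_generates : riesz_generates (range (embed i_ge0)).
Proof.
move=> B subB embB; have [linB supB] := subB.
have limF x : B (limit_op (i x)).
  by have [S <-] := limit_op_embed x; apply: embB; exists S.
have limB : [set z | B (limit_op z)] = setT.
  apply: (soc_minimal hFs) => [|_ [x _ <-]|u uincr [v uv]]; last 2 first.
  - exact: limF.
  - have [|z [[_ zub] zl]] := soc_complete hFs uincr; first by exists v.
    exists z; split; last by move=> w [_ wub]; apply: zl.
    split=> //=; rewrite -[z](subrK (i (u 0))) linearD.
    apply: linear_subspaceD => //; last exact: limF.
    apply: (limit_op_sup_seq subB embB uincr uv).
    by split=> // w wub; apply: zl.
  apply: sup_closed_sublattice => [|x y z Bx By zsup].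
    split=> [|a x y Bx By] /=; first by rewrite linear0; exact: linB.1.
    by rewrite linearP; exact: linB.2.
  by apply: (supB _ _ _ Bx By); left; exact: limit_op_sup.
apply/seteqP; split=> // T _.
have [S ->] := spaceH_change_limit T 0; apply: linear_subspaceD => //.
  by apply: embB; exists S.
by have : [set: Fs] (T (tail_seq 0) - i 0) by []; rewrite -limB.
Qed.

End Completion.

Theorem theorem3p5 (R : realType) (F Fs : rieszType R) (i : {linear F -> Fs})
    (hF : archimedean F) (hFs : seq_order_closure i) :
  exists j : {linear regop (linf0 R) F -> spaceH i},
    (forall (T : regop (linf0 R) F) (x : linf0 R), j T x = i (T x)) /\
    riesz_completion j.
Proof.
exists (embed (soc_bipositive hFs)); split=> //.
split; [exact: spaceH_riesz|exact: embed_bipositive|exact: embed_dense|].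
exact: embed_generates.
Qed.
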